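(* Let $n\ge1$ and let $\varphi:\mathbb{R}^+\to\mathbb{R}^+\cup\{0\}$ be bounded and non-increasing with $\int_{\mathbb{R}^n}|x|^n\varphi(|x|)\,dx<\infty$. For $j\in\mathbb{Z}^+$ let $\Pi_j$ be the joint distribution of a positive random variable $\varepsilon_j$ and an $\mathbb{R}^n$-valued random vector $y_j$. Assume that $d\Pi_j=\gamma_j\,ds\,dy$ and that there are a constant $A>0$ and numbers $r_j>0$ such that, for every $j$, $\operatorname{supp}\gamma_j\subseteq[0,r_j]\times\overline{B}(0,r_j)$ and $\|\gamma_j\|_\infty\le\frac{A}{r_j^{n+1}}$. Then $\mathscr{M}f$ is dominated by the Hardy-Littlewood maximal function $f^*$, i.e. there is a constant $C>0$, independent of $f$ and $x$, such that $\mathscr{M}f(x)\le Cf^*(x)$ for every measurable $f$ on $\mathbb{R}^n$ and every $x\in\mathbb{R}^n$.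
   Context: $\mathbb{R}^+=\{t\in\mathbb{R}:t>0\}$, $\mathbb{Z}^+=\{1,2,3,\dots\}$; $B(x,r)$ and $\overline{B}(x,r)$ are the open and closed Euclidean balls in $\mathbb{R}^n$. The random variables $\varepsilon_j$ and vectors $y_j$ are defined on a probability space $(\Omega,\mathscr{F},\mathscr{P})$ with expectation $\mathscr{E}$, and $\Pi_j(E)=\mathscr{P}(\{\omega:(\varepsilon_j(\omega),y_j(\omega))\in E\})$ for Borel $E\subseteq\mathbb{R}^{n+1}$. The maximal operator is $$\mathscr{M}f(x)=\sup_{j\geq 1}\mathscr{E}\left[\int_{z\in\mathbb{R}^n}\frac{1}{\varepsilon_j^n(\omega)}\varphi\left(\frac{|x-y_j(\omega)-z|}{\varepsilon_j(\omega)}\right)|f(z)|\,dz\right].$$ The Hardy-Littlewood maximal function on centered balls is $f^*(x)=\sup_{r>0}\frac{1}{|B(x,r)|}\int_{B(x,r)}|f(z)|\,dz$. *)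

(* Defs.v *)
From HB Require Import structures.
From mathcomp Require Import all_boot all_order all_algebra.
From mathcomp Require Import all_classical all_reals all_analysis.
From mathcomp Require Import measurable_realfun lra.

Set Implicit Arguments.
Unset Strict Implicit.
Unset Printing Implicit Defensive.
Import Order.TTheory GRing.Theory Num.Def Num.Theory.
Import numFieldNormedType.Exports.

Local Open Scope classical_set_scope.
Local Open Scope ring_scope.

Definition rV_display : measure_display -> measure_display.
Proof. exact. Qed.

(* The sigma-algebra generated by the coordinates; it is the Borel
   sigma-algebra, see measurable_rV_Borel. *)
Section measurable_rV.
Context {R : realType} (n : nat).

Definition rV_coord (i : 'I_n) (v : 'rV[R]_n) : R := v ord0 i.

Let rV_set0 : g_sigma_preimage rV_coord set0.
Proof. exact: sigma_algebra0. Qed.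

Let rV_setC A : g_sigma_preimage rV_coord A -> g_sigma_preimage rV_coord (~` A).
Proof. exact: sigma_algebraC. Qed.

Let rV_bigcup (F : _^nat) : (forall i, g_sigma_preimage rV_coord (F i)) ->
  g_sigma_preimage rV_coord (\bigcup_i (F i)).
Proof. exact: sigma_algebra_bigcup. Qed.

HB.instance Definition _ :=
  @isMeasurable.Build (rV_display default_measure_display)
    'rV[R]_n (g_sigma_preimage rV_coord) rV_set0 rV_setC rV_bigcup.

Lemma measurable_rV_coord (i : 'I_n) :
  measurable_fun [set: 'rV[R]_n] (fun v : 'rV[R]_n => v ord0 i).
Proof.
move=> _ Y mY; rewrite setTI; apply: sub_sigma_algebra => /=.
rewrite -bigcup_seq/=; exists i => /=; first by rewrite mem_index_enum.
by exists Y => //; rewrite setTI.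
Qed.

Lemma measurable_fun_rVP d (T : measurableType d) (f : T -> 'rV[R]_n) :
  measurable_fun [set: T] f <->
  forall i, measurable_fun [set: T] (fun t => f t ord0 i).
Proof.
split=> [mf i|mf]; first exact: measurableT_comp (measurable_rV_coord i) mf.
suff : g_sigma_preimage (fun i => rV_coord i \o f) `<=` measurable.
  rewrite g_sigma_preimage_comp => prefS _ A mA.
  by apply: prefS; exists A.
apply: smallest_sub; first exact: sigma_algebra_measurable.
rewrite -bigcup_seq; apply: bigcup_sub => i _.
by move=> A [B mB <-]; exact: mf.
Qed.

(* Every open set is a countable union of boxes with rational data. *)
Lemma open_measurable_rV (U : set 'rV[R]_n) : open U -> measurable U.
Proof.
move=> oU.
pose box (p : 'rV[rat]_n * rat) : set 'rV[R]_n :=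
  [set v | forall i, ratr (p.1 ord0 i) - ratr p.2 < v ord0 i
                     < ratr (p.1 ord0 i) + ratr p.2].
have mbox p : measurable (box p).
  rewrite (_ : box p = \big[setI/setT]_(i < n) ((fun v : 'rV[R]_n => v ord0 i)
     @^-1` `](ratr (p.1 ord0 i) - ratr p.2), (ratr (p.1 ord0 i) + ratr p.2)[)).
    apply: bigsetI_measurable => i _.
    rewrite -[X in measurable X]setTI; exact: measurable_rV_coord.
  rewrite -bigcap_seq; apply/seteqP; split => v /= h i.
    by move=> _ /=; rewrite in_itv/=.
  by have := h i (mem_index_enum i); rewrite /= in_itv.
have -> : U = \bigcup_(p in [set p | box p `<=` U]) box p.
  apply/seteqP; split => [v Uv|v [p /= pU pv]]; last exact: pU.
  have : nbhs v U by apply: open_nbhs_nbhs.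
  rewrite -nbhs_ballE => -[e /= e0 veU].
  have e2 : 0 < e / 2 by rewrite divr_gt0.
  have [q] := rat_in_itvoo e2.
  rewrite in_itv/= => /andP[q0 qe].
  have /all_sig[c cP] : forall i : 'I_n, {r : rat | v ord0 i - ratr q < ratr r < v ord0 i + ratr q}.
    move=> i; apply: cid.
    have h : v ord0 i - ratr q < v ord0 i + ratr q.
      by rewrite ltrD2l gtrN.
    by have [r] := rat_in_itvoo h; rewrite in_itv/=; exists r.
  exists (\row_i c i, q); last first.
    move=> i /=; rewrite mxE; have /andP[] := cP i.
    by rewrite ltrBlDr ltrBlDr => -> ->.
  move=> w /= bw; apply: veU; split => // i j; rewrite (ord1 i).
  have := bw j; rewrite /= mxE => /andP[w1 w2]; have /andP[c1 c2] := cP j.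
  rewrite -ball_normE/= ltr_norml; apply/andP; split; lra.
rewrite bigcup_mkcond; apply: countable_bigcupT_measurable => [|p].
  exact: countableP.
by case: ifPn.
Qed.

Lemma measurable_rV_Borel : measurable = <<s @open 'rV[R]_n >>.
Proof.
apply/seteqP; split; last first.
  apply: smallest_sub; first exact: sigma_algebra_measurable.
  by move=> U oU; exact: open_measurable_rV.
apply: smallest_sub; first exact: smallest_sigma_algebra.
rewrite -bigcup_seq; apply: bigcup_sub => i _ A [B mB <-]; rewrite setTI.
have mS : sigma_algebra setT
    (image_set_system setT (rV_coord i) <<s @open 'rV[R]_n >>).
  exact/sigma_algebra_image/smallest_sigma_algebra.
rewrite -[_ @^-1` B]setTI.
have {}mB : (R.-ocitv.-measurable).-sigma.-measurable B by [].
rewrite RGenOpens.measurableE in mB.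
suff : <<s @RGenOpens.G R >> `<=`
    image_set_system setT (rV_coord i) <<s @open 'rV[R]_n >> by exact.
apply: smallest_sub => //.
move=> _ [a [b ->]]; rewrite /image_set_system/= setTI.
apply: sub_sigma_algebra; apply: open_comp; last exact: interval_open.
by move=> v _; exact: coord_continuous.
Qed.

End measurable_rV.

Definition rV_cons {R : realType} n (p : R * 'rV[R]_n) : 'rV[R]_n.+1 :=
  row_mx p.1%:M p.2.

Definition rV_uncons {R : realType} n (v : 'rV[R]_n.+1) : R * 'rV[R]_n :=
  (v ord0 ord0, \row_i v ord0 (lift ord0 i)).

Lemma rV_cons0 {R : realType} n (p : R * 'rV[R]_n) : rV_cons p ord0 ord0 = p.1.
Proof.
transitivity (row_mx p.1%:M p.2 ord0 (lshift n (ord0 : 'I_1))).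
  by congr (fun_of_matrix (row_mx _ _) _ _); exact: val_inj.
by rewrite row_mxEl mxE eqxx.
Qed.

Lemma rV_consS {R : realType} n (p : R * 'rV[R]_n) i :
  rV_cons p ord0 (lift ord0 i) = p.2 ord0 i.
Proof.
transitivity (row_mx p.1%:M p.2 ord0 (rshift 1 i)); last by rewrite row_mxEr.
by congr (fun_of_matrix (row_mx _ _) _ _); exact: val_inj.
Qed.

Lemma rV_consK {R : realType} n : cancel (@rV_cons R n) (@rV_uncons R n).
Proof.
move=> [t v]; rewrite /rV_uncons rV_cons0; congr pair.
by apply/rowP => i; rewrite mxE rV_consS.
Qed.

Lemma measurable_rV_cons {R : realType} n :
  measurable_fun [set: R * 'rV[R]_n] (@rV_cons R n).
Proof.
apply/measurable_fun_rVP => i; have [j ->|->] := unliftP ord0 i.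
  under eq_fun do rewrite rV_consS.
  exact: (measurableT_comp (measurable_rV_coord j) measurable_snd).
by under eq_fun do rewrite rV_cons0; exact: measurable_fst.
Qed.

Lemma measurable_rV_uncons {R : realType} n :
  measurable_fun [set: 'rV[R]_n.+1] (@rV_uncons R n).
Proof.
apply: measurable_fun_pair; first exact: measurable_rV_coord.
apply/measurable_fun_rVP => i; under eq_fun do rewrite mxE.
exact: measurable_rV_coord.
Qed.

Section lebesgue_rV.
Context {R : realType}.
Local Open Scope ereal_scope.

Section succ.
Variables (n : nat) (mu : {sigma_finite_measure set 'rV[R]_n -> \bar R}).

Definition lebesgue_rV_succ : set 'rV[R]_n.+1 -> \bar R :=
  pushforward (@lebesgue_measure R \x mu) (@rV_cons R n).

Let succ0 : lebesgue_rV_succ set0 = 0.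
Proof. by rewrite /lebesgue_rV_succ /pushforward preimage_set0 measure0. Qed.

Let succ_ge0 A : 0 <= lebesgue_rV_succ A.
Proof. by rewrite /lebesgue_rV_succ /pushforward measure_ge0. Qed.

Let succ_sigma_additive : semi_sigma_additive lebesgue_rV_succ.
Proof.
have mcons A : measurable A -> measurable (@rV_cons R n @^-1` A).
  by move=> mA; rewrite -[X in measurable X]setTI; exact: measurable_rV_cons.
move=> F mF tF mUF; rewrite /lebesgue_rV_succ /pushforward preimage_bigcup.
apply: measure_semi_sigma_additive; first by move=> k; exact: mcons.
  apply/trivIsetP => /= i j _ _ ij; rewrite -preimage_setI.
  by move/trivIsetP : tF => /(_ _ _ _ _ ij) ->//; rewrite preimage_set0.
by rewrite -preimage_bigcup; exact: mcons.
Qed.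

HB.instance Definition _ := isMeasure.Build _ _ _ lebesgue_rV_succ
  succ0 succ_ge0 succ_sigma_additive.

Let succ_sigma_finite : sigma_finite setT lebesgue_rV_succ.
Proof.
have /sigma_finiteP[F [TF ndF Foo]] := sigma_finiteT (@lebesgue_measure R).
have /sigma_finiteP[G [TG ndG Goo]] := sigma_finiteT mu.
exists (fun k => @rV_uncons R n @^-1` (F k `*` G k)).
  rewrite -preimage_bigcup (_ : \bigcup_k _ = setT) ?preimage_setT//.
  apply/seteqP; split => // -[t v] _.
  have [i _ Fi] : (\bigcup_i F i) t by rewrite -TF.
  have [j _ Gj] : (\bigcup_i G i) v by rewrite -TG.
  exists (maxn i j) => //; split => /=.
    by move: t Fi; exact/subsetPset/ndF/leq_maxl.
  by move: v Gj; exact/subsetPset/ndG/leq_maxr.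
move=> k; have [mF Fk] := Foo k; have [mG Gk] := Goo k; split.
  rewrite -[X in measurable X]setTI.
  by apply: measurable_rV_uncons => //; exact: measurableX.
rewrite /lebesgue_rV_succ /pushforward -comp_preimage.
rewrite (_ : _ \o _ = id) ?preimage_id; last first.
  by apply/funext => p; exact: rV_consK.
by rewrite product_measure1E// lte_mul_pinfty// ge0_fin_numE.
Qed.

HB.instance Definition _ := Measure_isSigmaFinite.Build _ _ _ lebesgue_rV_succ
  succ_sigma_finite.

End succ.

(* Lebesgue measure on the Borel sets of R^n, as an iterated product. *)
Fixpoint lebesgue_rV n : {sigma_finite_measure set 'rV[R]_n -> \bar R} :=
  if n is m.+1 then lebesgue_rV_succ (lebesgue_rV m) else \d_(0%R : 'rV[R]_0).

Lemma lebesgue_rV_box n (A : 'I_n -> set R) :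
  (forall i, measurable (A i)) ->
  lebesgue_rV n [set v | forall i, A i (v ord0 i)] =
  \prod_(i < n) @lebesgue_measure R (A i).
Proof.
elim: n A => [|n IH] A mA.
  by rewrite big_ord0 /= diracE mem_set//= => -[].
have mB : measurable [set v : 'rV[R]_n | forall i, A (lift ord0 i) (v ord0 i)].
  rewrite (_ : mkset _ = \big[setI/setT]_(i < n)
      ((fun v : 'rV[R]_n => v ord0 i) @^-1` A (lift ord0 i))).
    apply: bigsetI_measurable => i _.
    by rewrite -[X in measurable X]setTI; exact: measurable_rV_coord.
  rewrite -bigcap_seq; apply/seteqP; split => v /= h i.
    by move=> _; exact: h.
  exact: (h i (mem_index_enum i)).
rewrite big_ord_recl -IH//= /lebesgue_rV_succ /pushforward.
rewrite -product_measure1E//.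
congr (_ _); apply/seteqP; split => p /=.
  move=> h; split; first by have := h ord0; rewrite rV_cons0.
  by move=> i; have := h (lift ord0 i); rewrite rV_consS.
move=> [h0 hS] i; have [j ->|->] := unliftP ord0 i; last by rewrite rV_cons0.
by rewrite rV_consS.
exact: mA.
Qed.

End lebesgue_rV.
Arguments lebesgue_rV R n : clear implicits.

(* Measurability with respect to the completion of mu.  For such an f >= 0 the
   library's integral, a supremum over mu-measurable simple functions below f,
   is the integral of f against the completion. *)
Definition completed_measurable_fun d (T : measurableType d) (R : realType)
    (mu : set T -> \bar R) (f : T -> R) :=
  forall B : set R, measurable B -> completed_algebra_gen mu (f @^-1` B).

(* The norm of the library on 'rV[R]_n is the sup norm. *)
Definition enorm (R : realType) n (v : 'rV[R]_n) : R :=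
  Num.sqrt (\sum_(i < n) v ord0 i ^+ 2).

Definition eball (R : realType) n (x : 'rV[R]_n) (r : R) : set 'rV[R]_n :=
  [set v | enorm (v - x) < r].

Definition eclosed_ball (R : realType) n (x : 'rV[R]_n) (r : R) :
    set 'rV[R]_n :=
  [set v | enorm (v - x) <= r].

Definition HL_maximal_rV (R : realType) n (f : 'rV[R]_n -> R) (x : 'rV[R]_n) :
    \bar R :=
  ereal_sup [set ((lebesgue_rV R n (eball x r))^-1 *
    \int[lebesgue_rV R n]_(z in eball x r) `|(f z)%:E|)%E
  | r in [set r : R | 0 < r]].

Definition joint_distribution d (T : measurableType d) (R : realType)
    (P : probability T R) n (e : {RV P >-> R}) (y : {RV P >-> 'rV[R]_n}) :
    set (R * 'rV[R]_n) -> \bar R :=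
  pushforward P (fun w => (e w, y w)).

(* The radial profile phi lives on (0, +oo); its value at 0 is only used at the
   single point z = x - y j w. *)
Definition random_maximal (R : realType) n (phi : R -> R)
    d (Omega : measurableType d) (P : probability Omega R)
    (eps : nat -> {RV P >-> R}) (y : nat -> {RV P >-> 'rV[R]_n})
    (f : 'rV[R]_n -> R) (x : 'rV[R]_n) : \bar R :=
  ereal_sup [set (\int[P]_w \int[lebesgue_rV R n]_z
    ((eps j w ^+ n)^-1 * phi (enorm (x - y j w - z) / eps j w) * `|f z|)%:E)%E
  | j in [set j | (1 <= j)%N]].

(* Main.v *)
Require Import Defs.
From HB Require Import structures.
From mathcomp Require Import all_boot all_order all_algebra.
From mathcomp Require Import all_classical all_reals all_analysis.
From mathcomp Require Import measurable_realfun ess_sup_inf lra ring.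


(** Fix [x], write [f*] for the value at [x] of the maximal function of [f], and
    let [k_s(u) = s^-n phi(|u| / s)]. The joint law of [(eps j, y j)] is at most
    [A / r^(n+1)] times Lebesgue measure on [0, r] x B(0, r), where [r = r j]
    ([bounded_density_integral_le]), so the expectation at index [j] is at most
    [A / r^(n+1)] times the integral over [0 <= s <= r] of
    [I(s) = int_{|y| <= r} int_z k_s(x - y - z) |f z| dz dy].

    Substituting [u = y + z - x] and exchanging integrals, [I(s)] becomes the
    integral of [k_s(u)] against the integral of [|f|] over the ball of centre
    [x + u] and radius [r]. This ball lies in the one of centre [x] and radius
    [|u| + 2r], over which the integral of [|f|] is at most
    [(2 (|u| + 2r))^n f*] ([averaged_convolution_le] and
    [integral_eball_le_HL_maximal]). Rescaling [u = s v], with [s <= r], leaves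
    [I(s) <= (2r)^n f* int phi(|v|) (|v| + 2)^n dv]
    ([dilated_kernel_weighted_le]). The last integral is finite because [phi] is
    bounded and has a finite moment of order [n] ([profile_moment_lty]). The
    integration over [s] contributes a factor [r], and all powers of [r] cancel.

    The function [f] is measurable only for the completion of Lebesgue measure.
    It is replaced at the start by a Borel minorant of [|f|] that agrees with it
    almost everywhere ([completed_measurable_fun_envelope]): the minorant
    suffices under the expectation, where the bound goes up, and in the maximal
    function, where it goes down. *)

Set Implicit Arguments.
Unset Strict Implicit.
Unset Printing Implicit Defensive.
Import Order.TTheory GRing.Theory Num.Def Num.Theory.
Import numFieldNormedType.Exports.

Local Open Scope classical_set_scope.
Local Open Scope ring_scope.

(** * Integrals of functions that need not be measurable *)

Section integral_bounds.
Context d (T : measurableType d) (R : realType).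
Local Open Scope ereal_scope.
Import HBNNSimple.

(** The integral of a nonnegative function is a supremum over the simple functions
    below it, so it is monotone for arbitrary functions; and dropping the negative
    part of [f] only increases its integral. The integrands of the theorem involve
    a completion-measurable [f], and expectations of functions whose measurability
    is not known, so monotonicity is needed in this generality. *)
Lemma le_integral_ge0 (mu : {measure set T -> \bar R}) (D : set T)
    (f g : T -> \bar R) :
  (forall x, D x -> 0 <= g x) -> (forall x, D x -> f x <= g x) ->
  \int[mu]_(x in D) f x <= \int[mu]_(x in D) g x.
Proof.
move=> g0 fg; rewrite [leLHS]integralE.
have fn0 : 0 <= \int[mu]_(x in D) f^\- x.
  by apply: integral_ge0 => x _; exact: funeneg_ge0.
apply: (@le_trans _ _ (\int[mu]_(x in D) f^\+ x)).
  by rewrite -[leRHS]sube0 leeB.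
rewrite (ge0_integralE _ g0) ge0_integralE; last first.
  by move=> x _; exact: funepos_ge0.
apply: le_ereal_sup => _ [h /= hf <-]; exists h => //= x.
apply: (le_trans (hf x)); rewrite /patch; case: ifPn => // xD.
rewrite funeposE; have xD' := set_mem xD.
by rewrite ge_max fg// g0.
Qed.

(** Raising [g] to [+oo] on the exceptional null set turns an almost everywhere
    bound into an everywhere bound without changing the integral of [g]. *)
Lemma ae_le_integral_ge0 (mu : {measure set T -> \bar R}) (D : set T)
    (f g : T -> \bar R) :
  measurable D -> measurable_fun setT g -> (forall x, 0 <= g x) ->
  {ae mu, forall x, D x -> f x <= g x} ->
  \int[mu]_(x in D) f x <= \int[mu]_(x in D) g x.
Proof.
move=> mD mg g0 [N [mN N0 fgN]].
pose g' x := if x \in N then +oo else g x.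
have g'0 x : 0 <= g' x by rewrite /g'; case: ifPn.
have mg' : measurable_fun setT g'.
  apply: measurable_fun_ifT => //; apply: (measurable_fun_bool true).
  rewrite setTI (_ : _ @^-1` _ = N)//.
  by apply/seteqP; split => x /=; [exact: set_mem|exact: mem_set].
have -> : \int[mu]_(x in D) g x = \int[mu]_(x in D) g' x.
  apply: ge0_ae_eq_integral => //; [exact: measurable_funS mg|
    exact: measurable_funS mg'|].
  exists N; split => // x /=; apply: contra_notP => xN _.
  by rewrite /g' memNset.
apply: le_integral_ge0 => // x Dx; rewrite /g'; case: ifPn => [_|xN].
  exact: leey.
apply: contrapT => fgx; move: xN; rewrite notin_setE; apply.
by apply: fgN => /= /(_ Dx).
Qed.

Lemma le_measure_integral (m1 m2 : {measure set T -> \bar R}) (f : T -> \bar R) :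
  (forall x, 0 <= f x) ->
  (forall S, measurable S -> m1 S <= m2 S) ->
  \int[m1]_x f x <= \int[m2]_x f x.
Proof.
move=> f0 m12; rewrite !ge0_integralTE//.
apply: ge_ereal_sup => _ [h /= hf <-].
apply: (le_trans (le_measure_sintegral m12 h)).
by apply: ereal_sup_ubound; exists h.
Qed.

(** Each superlevel set of [|f|] at a rational level [q] contains a measurable [A q]
    of full measure in it, and [h] is the supremum of the functions equal to [q]
    on [A q] and to [0] elsewhere. Hence integrals of [|f|] are bounded below by
    those of [h] because [h <= |f|], and bounded above by them because
    [h = |f|] almost everywhere. *)
Lemma completed_measurable_fun_envelope (mu : {measure set T -> \bar R})
    (f : T -> R) :
  completed_measurable_fun mu f ->
  exists h : T -> \bar R, [/\ measurable_fun setT h, forall x, 0 <= h x,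
    forall x, h x <= `|(f x)%:E| & {ae mu, forall x, h x = `|(f x)%:E|}].
Proof.
move=> mf.
have /choice[A AP] : forall q : rat, exists A : set T, measurable A /\
    (A `<=` [set x | (ratr q < `|f x|)%R] /\
     mu.-negligible ([set x | (ratr q < `|f x|)%R] `\` A)).
  move=> q; have mB : measurable [set y : R | (ratr q < `|y|)%R].
    rewrite (_ : mkset _ = normr @^-1` `](ratr q), +oo[).
      by rewrite -[_ @^-1` _]setTI; exact: normr_measurable.
    by apply/seteqP; split => y /=; rewrite in_itv/= andbT.
  have [A mA [N N0 ANE]] := mf _ mB.
  exists A; split => //; split.
    by move=> x Ax; have : (A `|` N) x by [left]; rewrite ANE.
  apply: negligibleS N0 => x [/= fx nAx].
  by have : (A `|` N) x; [rewrite ANE|case=> // /nAx].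
pose u (k : nat) (x : T) : \bar R :=
  if unpickle k is Some q then
    (if (x \in A q) && (0 <= q)%R then (ratr q)%:E else 0) else 0.
have mu' k : measurable_fun setT (u k).
  rewrite /u; case: unpickle => [q|//].
  apply: measurable_fun_ifT => //; apply: measurable_and => //.
  apply: (measurable_fun_bool true); rewrite setTI.
  rewrite (_ : _ @^-1` _ = A q); first by have [] := AP q.
  by apply/seteqP; split => x /=; [exact: set_mem|exact: mem_set].
have u0 k x : 0 <= u k x.
  rewrite /u; case: unpickle => [q|//]; case: ifPn => // /andP[_ q0].
  by rewrite lee_fin ler0q.
have uf k x : u k x <= `|(f x)%:E|.
  rewrite /u; case: unpickle => [q|//]; case: ifPn => // /andP[+ _].
  rewrite inE => /(proj1 (proj2 (AP q))) /= /ltW.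
  by rewrite -lee_fin.
exists (fun x => esups (u ^~ x) 0%N); split.
- exact: measurable_fun_esups.
- move=> x; apply: (le_trans (u0 0%N x)); apply: ereal_sup_ubound.
  by exists 0%N.
- by move=> x; apply: ge_ereal_sup => _ [k _ <-].
(* Off these countably many null sets, a rational strictly between [h x] and
   [|f x|] would be a lower bound of the supremum defining [h x]. *)
apply: (@negligibleS _ _ _ _ (\bigcup_k
    if unpickle k is Some q then [set x | (ratr q < `|f x|)%R] `\` A q
    else set0)); last first.
  apply: negligible_bigcup => k; case: unpickle => [q|].
    exact: (proj2 (proj2 (AP q))).
  exact: negligible_set0.
move=> x /=; apply: contra_notP => nx.
apply/eqP; rewrite eq_le; apply/andP; split.
  by apply: ge_ereal_sup => _ [k _ <-].
rewrite leNgt; apply/negP.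
have us k : u k x <= esups (u ^~ x) 0%N by apply: ereal_sup_ubound; exists k.
move: (esups _ _) us => s us sf.
have s0 : 0 <= s by exact: le_trans (us 0%N).
have sfin : s \is a fin_num.
  by rewrite ge0_fin_numE// (lt_le_trans sf)// leey.
have {}sf : (fine s < `|f x|)%R by rewrite -lte_fin fineK.
have [q] := rat_in_itvoo sf; rewrite in_itv/= => /andP[sq qf].
have q0 : (0 <= q)%R.
  by rewrite -(ler0q R) (le_trans _ (ltW sq))// fine_ge0.
have Aq : x \in A q.
  rewrite inE; apply: contrapT => nA; apply: nx.
  by exists (pickle q); [exact: I|rewrite pickleK].
have := us (pickle q); rewrite /u pickleK Aq q0 /=; apply/negP.
by rewrite -ltNge -(fineK sfin) lte_fin.
Qed.

End integral_bounds.

(** * Measures with a bounded density supported in a given set *)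

Section bounded_density.
Context d (T : measurableType d) (R : realType).
Variables (nu m : {measure set T -> \bar R}) (g : T -> R) (S : set T) (c : R).
Local Open Scope ereal_scope.
Hypothesis mS : measurable S.
Hypothesis gS : forall t, ~ S t -> g t = 0%R.
Hypothesis g_density : forall E, measurable E -> nu E = \int[m]_(t in E) (g t)%:E.
Hypothesis c0 : (0 <= c)%R.
Hypothesis gc : ('N[m]_+oo[EFin \o g] <= c%:E)%E.

Lemma Lnormy_ae_le : {ae m, forall t, (g t)%:E <= c%:E}.
Proof.
move: gc; rewrite unlock; case: ifPn => [_ /ess_supP|mT _].
  apply: filterS => t /=; apply: le_trans.
  by rewrite lee_fin ler_norm.
exists setT; split => //; apply/eqP; rewrite eq_le measure_ge0 andbT.
by rewrite leNgt.
Qed.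

(** The measure [nu] does not charge the complement of [S] and is at most [c] times
    [m] on every measurable set, because [g] vanishes off [S] and is at most [c]
    almost everywhere. *)
Lemma bounded_density_integral_le (G : T -> \bar R) :
  measurable_fun setT G -> (forall t, 0 <= G t) ->
  \int[nu]_t G t <= c%:E * \int[m]_(t in S) G t.
Proof.
move=> mG G0.
have nuS : nu (~` S) = 0.
  rewrite g_density; last exact: measurableC.
  by apply: integral0_eq => t /gS ->.
rewrite (@ge0_negligible_integral _ _ _ nu setT (~` S) G)//; last first.
  exact: measurableC.
rewrite setTD setCK integral_mkcond [in leRHS]integral_mkcond.
pose cn : {nonneg R} := NngNum c0.
have GS0 t : 0 <= (G \_ S) t by apply: erestrict_ge0.
rewrite -[leRHS](ge0_integral_mscale _ _ cn)//; last first.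
  by apply/(measurable_restrictT _ mS); exact: measurable_funS mG.
apply: le_measure_integral => // E mE.
rewrite g_density//; apply: (@le_trans _ _ (\int[m]_(t in E) c%:E)); last first.
  by rewrite integral_cst.
apply: ae_le_integral_ge0 => //.
by apply: filterS Lnormy_ae_le.
Qed.

End bounded_density.


(** * The Euclidean norm and the volume of balls *)

Section euclidean_norm.
Context {R : realType} (n : nat).
Implicit Types u v : 'rV[R]_n.

Lemma enorm_ge0 v : 0 <= enorm v.
Proof. exact: sqrtr_ge0. Qed.

Lemma enorm_sqr v : enorm v ^+ 2 = \sum_(i < n) v ord0 i ^+ 2.
Proof. by rewrite sqr_sqrtr// sumr_ge0// => i _; exact: sqr_ge0. Qed.

Lemma enorm0 : enorm (0 : 'rV[R]_n) = 0.
Proof.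
by rewrite /enorm big1 ?sqrtr0// => i _; rewrite mxE expr0n.
Qed.

Lemma enormN v : enorm (- v) = enorm v.
Proof.
by congr Num.sqrt; apply: eq_bigr => i _; rewrite mxE sqrrN.
Qed.

Lemma enormZ (s : R) v : 0 <= s -> enorm (s *: v) = s * enorm v.
Proof.
move=> s0; rewrite /enorm.
rewrite (eq_bigr (fun i => s ^+ 2 * v ord0 i ^+ 2)); last first.
  by move=> i _; rewrite mxE exprMn.
by rewrite -mulr_sumr sqrtrM ?sqr_ge0// sqrtr_sqr ger0_norm.
Qed.

Lemma ler_coord_enorm v i : `|v ord0 i| <= enorm v.
Proof.
rewrite -sqrtr_sqr ler_sqrt; last by apply: sumr_ge0 => j _; exact: sqr_ge0.
by rewrite (bigD1 i)//= lerDl sumr_ge0// => j _; exact: sqr_ge0.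
Qed.

Lemma enorm_gt0 v : v != 0 -> 0 < enorm v.
Proof.
move=> v0; rewrite lt_neqAle enorm_ge0 andbT eq_sym.
apply: contra v0 => /eqP v0; apply/eqP/rowP => i; rewrite mxE.
by apply/eqP; rewrite -normr_le0 -v0 ler_coord_enorm.
Qed.

(** Cauchy-Schwarz, from the nonnegativity of the square of the norm of
    [enorm v *: u - enorm u *: v]. *)
Lemma dot_le_enormM u v :
  \sum_(i < n) u ord0 i * v ord0 i <= enorm u * enorm v.
Proof.
have [->|/enorm_gt0 u0] := eqVneq u 0.
  by rewrite enorm0 mul0r big1// => i _; rewrite mxE mul0r.
have [->|/enorm_gt0 v0] := eqVneq v 0.
  by rewrite enorm0 mulr0 big1// => i _; rewrite mxE mulr0.
have : 0 <= \sum_(i < n) (enorm v * u ord0 i - enorm u * v ord0 i) ^+ 2.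
  by apply: sumr_ge0 => i _; exact: sqr_ge0.
rewrite (eq_bigr (fun i => enorm v ^+ 2 * u ord0 i ^+ 2 +
    enorm u ^+ 2 * v ord0 i ^+ 2 -
    (2 * (enorm u * enorm v)) * (u ord0 i * v ord0 i))); last first.
  by move=> i _; lra.
rewrite sumrB big_split/= -!mulr_sumr -!enorm_sqr subr_ge0.
have -> : enorm v ^+ 2 * enorm u ^+ 2 + enorm u ^+ 2 * enorm v ^+ 2 =
   2 * (enorm u * enorm v) * (enorm u * enorm v) by lra.
by rewrite ler_pM2l// mulr_gt0 ?mulr_gt0.
Qed.

Lemma enormD u v : enorm (u + v) <= enorm u + enorm v.
Proof.
rewrite -(@ler_pXn2r _ 2%N)// ?nnegrE ?addr_ge0 ?enorm_ge0//.
rewrite enorm_sqr sqrrD !enorm_sqr.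
rewrite (eq_bigr (fun i => u ord0 i ^+ 2 + (u ord0 i * v ord0 i) *+ 2
   + v ord0 i ^+ 2)); last by move=> i _; rewrite mxE sqrrD.
rewrite !big_split/= lerD2r lerD2l mulr2n.
by rewrite lerD ?dot_le_enormM.
Qed.

Lemma measurable_rVD d (T : measurableType d) (f g : T -> 'rV[R]_n) :
  measurable_fun setT f -> measurable_fun setT g ->
  measurable_fun setT (fun t => f t + g t)%R.
Proof.
move=> /measurable_fun_rVP mf /measurable_fun_rVP mg.
apply/measurable_fun_rVP => i; under eq_fun do rewrite mxE.
exact: measurable_funD.
Qed.

Lemma measurable_rVN d (T : measurableType d) (f : T -> 'rV[R]_n) :
  measurable_fun setT f -> measurable_fun setT (fun t => - f t)%R.
Proof.
move=> /measurable_fun_rVP mf.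
apply/measurable_fun_rVP => i; under eq_fun do rewrite mxE.
exact: measurable_funN.
Qed.

Lemma measurable_enorm : measurable_fun setT (@enorm R n).
Proof.
apply: (@measurableT_comp _ _ _ _ _ _ (@Num.sqrt R)).
  by apply: continuous_measurable_fun; exact: sqrt_continuous.
apply: measurable_sum => i; apply: measurable_funX; exact: measurable_rV_coord.
Qed.

Lemma measurable_enormB (x : 'rV[R]_n) :
  measurable_fun setT (fun v => enorm (v - x)).
Proof.
apply: (measurableT_comp measurable_enorm); apply/measurable_fun_rVP => i.
under eq_fun do rewrite !mxE.
by apply: measurable_funB => //; exact: measurable_rV_coord.
Qed.

Lemma measurable_eball (x : 'rV[R]_n) r : measurable (eball x r).
Proof.
rewrite (_ : eball x r = (fun v => enorm (v - x)) @^-1` `]-oo, r[); last first.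
  by apply/seteqP; split => v /=; rewrite in_itv.
by rewrite -[X in measurable X]setTI; exact: measurable_enormB.
Qed.

Lemma measurable_eclosed_ball (x : 'rV[R]_n) r : measurable (eclosed_ball x r).
Proof.
rewrite (_ : eclosed_ball x r =
    (fun v => enorm (v - x)) @^-1` `]-oo, r]); last first.
  by apply/seteqP; split => v /=; rewrite in_itv.
by rewrite -[X in measurable X]setTI; exact: measurable_enormB.
Qed.

(** The ball lies in a cube of side [2 * r]. *)
Lemma lebesgue_rV_eball_le (x : 'rV[R]_n) (r : R) : 0 <= r ->
  (lebesgue_rV R n (eball x r) <= ((2 * r) ^+ n)%:E)%E.
Proof.
move=> r0.
pose B (i : 'I_n) : set R := `](x ord0 i - r), (x ord0 i + r)[%classic.
have -> : ((2 * r) ^+ n)%:E = (\prod_(i < n) lebesgue_measure (B i))%E.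
  rewrite (eq_bigr (fun=> (2 * r)%:E)); last first.
    move=> i _; rewrite lebesgue_measure_itv/= lte_fin.
    case: ltP => h; first by rewrite -EFinB; congr EFin; lra.
    by congr EFin; lra.
  by rewrite prodEFin prodr_const card_ord.
rewrite -lebesgue_rV_box; last by move=> i; exact: measurable_itv.
apply: le_measure; rewrite ?inE.
- exact: measurable_eball.
- rewrite [X in measurable X](_ : _ = \big[setI/setT]_(i < n)
      ((fun v : 'rV[R]_n => v ord0 i) @^-1` B i)).
    apply: bigsetI_measurable => i _.
    rewrite -[X in measurable X]setTI; apply: measurable_rV_coord => //.
    exact: measurable_itv.
  rewrite -bigcap_seq; apply/seteqP; split => v /= h i.
    by move=> _; exact: h.
  exact: (h i (mem_index_enum i)).
- move=> v /= vx i; rewrite /B /= in_itv/= -ltr_distl.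
  by apply: le_lt_trans vx; rewrite (le_trans _ (ler_coord_enorm _ i))// !mxE.
Qed.

End euclidean_norm.

(** * Affine changes of variables *)

Section affine.
Context {R : realType}.
Local Open Scope ereal_scope.

Lemma lebesgue_measure_affine (s b : R) (A : set R) : (0 < s)%R -> measurable A ->
  lebesgue_measure A =
    s%:E * lebesgue_measure ((fun t => (s * t + b)%R) @^-1` A).
Proof.
move=> s0 mA.
pose f (t : R) : measurableTypeR R := (s * t + b)%R.
have mf : measurable_fun setT (f : measurableTypeR R -> measurableTypeR R).
  by apply: measurable_funD => //; exact: mulrl_measurable.
pose sn : {nonneg R} := NngNum (ltW s0).
pose m' := mscale sn (pushforward lebesgue_measure f).
change (lebesgue_measure A = m' mf A).
apply: lebesgue_measure_unique => // _ [[p q] /= _ <-].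
rewrite /m' /mscale/= /pushforward.
rewrite (_ : f @^-1` _ = `](s^-1 * (p - b))%R, (s^-1 * (q - b))%R]%classic); last first.
  apply/seteqP; split => t /=; rewrite !in_itv/= /f ltr_pdivrMl// ler_pdivlMl//;
  by rewrite ltrBlDr lerBrDr.
rewrite !lebesgue_measure_itv/= !lte_fin ltr_pM2l ?invr_gt0// ltrD2r.
case: ifPn => _; last by rewrite mule0.
by rewrite -EFinB -EFinM; congr EFin; field; exact: lt0r_neq0.
Qed.

Definition rV_affine n (s : R) (b v : 'rV[R]_n) : 'rV[R]_n := s *: v + b.

Lemma rV_affineE n (s : R) (b v : 'rV[R]_n) i :
  rV_affine s b v ord0 i = (s * v ord0 i + b ord0 i)%R.
Proof. by rewrite !mxE. Qed.

Lemma measurable_rV_affine n (s : R) (b : 'rV[R]_n) :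
  measurable_fun setT (rV_affine s b).
Proof.
apply/measurable_fun_rVP => i; under eq_fun do rewrite !mxE.
apply: measurable_funD => //; apply: measurable_funM => //.
exact: measurable_rV_coord.
Qed.

(** By induction on the dimension: both sides are measures on a product that agree
    on rectangles. *)
Lemma lebesgue_rV_affine n (s : R) (b : 'rV[R]_n) (A : set 'rV[R]_n) :
  (0 < s)%R -> measurable A ->
  lebesgue_rV R n A = (s ^+ n)%:E * lebesgue_rV R n (rV_affine s b @^-1` A).
Proof.
move=> s0; elim: n b A => [|n IH] b A mA.
  rewrite expr0 mul1e /= !diracE.
  have -> // : rV_affine s b @^-1` A = A.
  apply/seteqP; split => v; rewrite /= [rV_affine _ _ _]thinmx0 [v]thinmx0//.
pose b0 := b ord0 ord0; pose b' : 'rV[R]_n := \row_i b ord0 (lift ord0 i).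
pose f (p : measurableTypeR R * 'rV[R]_n) : measurableTypeR R * 'rV[R]_n :=
  ((s * p.1 + b0)%R, rV_affine s b' p.2).
have mf : measurable_fun setT f.
  apply: measurable_fun_pair.
    apply: measurable_funD => //; apply: measurable_funM => //.
  exact: (measurableT_comp (measurable_rV_affine s b') measurable_snd).
pose sn : {nonneg R} := NngNum (exprn_ge0 n.+1 (ltW s0)).
pose m' := mscale sn (pushforward (lebesgue_measure \x lebesgue_rV R n) f).
rewrite /= /lebesgue_rV_succ {1}/pushforward.
transitivity (m' mf (@rV_cons R n @^-1` A)).
  apply: (@product_measure_unique _ _ _ _ _ _ _ (m' mf)); last first.
    by rewrite -[X in measurable X]setTI; exact: measurable_rV_cons.
  move=> B C mB mC; rewrite /m' /mscale/= /pushforward.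
  transitivity ((s ^+ n.+1)%:E * (lebesgue_measure \x lebesgue_rV R n)
      (((fun t => (s * t + b0)%R) @^-1` B) `*` (rV_affine s b' @^-1` C))) => //.
  rewrite product_measure1E.
  - rewrite (lebesgue_measure_affine b0 s0 mB) (IH b' C)//.
    by rewrite [RHS]muleACA -EFinM -exprS.
  - rewrite -[X in measurable X]setTI.
    apply: measurable_funD => //; exact: mulrl_measurable.
  - by rewrite -[X in measurable X]setTI; exact: measurable_rV_affine.
rewrite /m' /mscale/= /pushforward; congr (_ * (lebesgue_measure \x _) _).
have fE p : rV_cons (f p) = rV_affine s b (rV_cons p).
  apply/rowP => i; have [j ->|->] := unliftP ord0 i.
    by rewrite rV_affineE !rV_consS rV_affineE mxE.
  by rewrite rV_affineE !rV_cons0.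
by apply/seteqP; split => p /=; rewrite fE.
Qed.

Lemma ge0_integral_rV_affine n (s : R) (b : 'rV[R]_n) (F : 'rV[R]_n -> \bar R) :
  (0 < s)%R -> measurable_fun setT F -> (forall v, 0 <= F v) ->
  \int[lebesgue_rV R n]_v F v =
  (s ^+ n)%:E * \int[lebesgue_rV R n]_v F (s *: v + b)%R.
Proof.
move=> s0 mF F0.
pose sn : {nonneg R} := NngNum (exprn_ge0 n (ltW s0)).
have mf := measurable_rV_affine s b.
pose m' := mscale sn (pushforward (lebesgue_rV R n) (rV_affine s b)).
rewrite (eq_measure_integral (m' mf)); last first.
  by move=> A mA _; exact: lebesgue_rV_affine.
rewrite ge0_integral_mscale//; congr (_ * _).
by rewrite ge0_integral_pushforward.
Qed.

End affine.

(** * Averaging a convolution over its centre *)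

Section convolution_bound.
Context {R : realType} (n : nat).
Local Open Scope ereal_scope.
Local Notation mu := (lebesgue_rV R n).
Variables (K : 'rV[R]_n -> R) (h : 'rV[R]_n -> \bar R) (x : 'rV[R]_n) (H : \bar R).
Hypothesis mK : measurable_fun setT K.
Hypothesis K0 : forall u, (0 <= K u)%R.
Hypothesis KN : forall u, K (- u)%R = K u.
Hypothesis mh : measurable_fun setT h.
Hypothesis h0 : forall z, 0 <= h z.
Hypothesis H0 : 0 <= H.
(* The averages of [h] over the balls centred at [x] are bounded by [H]; in the
   end [H] is the value at [x] of the maximal function. *)
Hypothesis hH : forall rho : R, (0 < rho)%R ->
  \int[mu]_(z in eball x rho) h z <= ((2 * rho) ^+ n)%:E * H.

(** Put [u = y + z - x]. By Tonelli the left-hand side is the integral in [u] of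
    [K u] times the integral of [h] over the closed ball of centre [x + u] and
    radius [r]. That ball sits inside the ball centred at [x] of radius
    [enorm u + 2 * r], over which the integral of [h] is controlled by [H]. The
    average over [y] is essential: it replaces the value of [h] at [x + u], which
    [H] does not control, by an integral over a ball of radius [r]. *)
Lemma averaged_convolution_le (r : R) : (0 < r)%R ->
  \int[mu]_(y in eclosed_ball 0%R r) \int[mu]_z ((K (x - y - z))%:E * h z) <=
  \int[mu]_u ((K u * (2 * (enorm u + 2 * r)) ^+ n)%:E * H).
Proof.
move=> r0; set B := eclosed_ball _ _.
have mB : measurable B by exact: measurable_eclosed_ball.
pose F (p : 'rV[R]_n * 'rV[R]_n) : \bar R :=
  (\1_B p.1 * K (x - p.1 - p.2))%:E * h p.2.
pose G (p : 'rV[R]_n * 'rV[R]_n) : \bar R :=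
  (\1_B (p.1 + x - p.2)%R * K p.1)%:E * h p.2.
have F0 p : 0 <= F p by rewrite mule_ge0// lee_fin mulr_ge0.
have G0 p : 0 <= G p by rewrite mule_ge0// lee_fin mulr_ge0.
have mF : measurable_fun setT F.
  apply: emeasurable_funM; last exact: (measurableT_comp mh measurable_snd).
  apply/measurable_EFinP; apply: measurable_funM.
    exact: (measurableT_comp (measurable_indic mB) measurable_fst).
  apply: (measurableT_comp mK); apply: measurable_rVD; last first.
    by apply: measurable_rVN; exact: measurable_snd.
  apply: measurable_rVD => //; apply: measurable_rVN; exact: measurable_fst.
have mG : measurable_fun setT G.
  apply: emeasurable_funM; last exact: (measurableT_comp mh measurable_snd).
  apply/measurable_EFinP; apply: measurable_funM; last first.
    exact: (measurableT_comp mK measurable_fst).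
  apply: (measurableT_comp (measurable_indic mB)); apply: measurable_rVD.
    by apply: measurable_rVD => //; exact: measurable_fst.
  by apply: measurable_rVN; exact: measurable_snd.
have -> : \int[mu]_(y in B) \int[mu]_z ((K (x - y - z))%:E * h z) =
    \int[mu]_y \int[mu]_z F (y, z).
  rewrite integral_mkcond; apply: eq_integral => y _.
  rewrite /F/= patchE indicE; case: ifPn => yB.
    by apply: eq_integral => z _; rewrite mul1r.
  by apply/esym/integral0_eq => z _; rewrite mul0r mul0e.
rewrite fubini_tonelli//.
have -> : \int[mu]_z \int[mu]_y F (y, z) = \int[mu]_z \int[mu]_u G (u, z).
  apply: eq_integral => z _.
  rewrite (@ge0_integral_rV_affine _ _ 1 (x - z)%R)//; last first.
    exact: (measurableT_comp mF (measurable_pair2 z)).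
  rewrite expr1n mul1e; apply: eq_integral => u _.
  rewrite /F /G /= scale1r -[in RHS]KN -[(u + x - z)%R]addrA;
  congr (((_ * K _)%R)%:E * _).
  by rewrite opprD opprB addrCA [(x + (z - x))%R]addrC subrK addrK.
rewrite -fubini_tonelli//.
apply: le_integral_ge0 => u _.
  rewrite mule_ge0 ?lee_fin ?mulr_ge0 ?exprn_ge0//.
  by rewrite mulr_ge0// addr_ge0 ?enorm_ge0// mulr_ge0// ltW.
(* With radius [enorm u + 2 * r], rather than [enorm u + r], the closed ball fits
   into an open one. *)
have ru : (0 < enorm u + 2 * r)%R by rewrite ltr_wpDl ?enorm_ge0 ?mulr_gt0.
rewrite EFinM -muleA.
apply: (@le_trans _ _ ((K u)%:E * \int[mu]_(z in eball x (enorm u + 2 * r)) h z)).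
  rewrite -ge0_integralZl//; last 3 first.
  - exact: measurable_eball.
  - exact: measurable_funS mh.
  - by rewrite lee_fin.
  rewrite integral_mkcond; apply: le_integral_ge0 => z _.
    by apply: erestrict_ge0 => w _; rewrite mule_ge0// lee_fin.
  rewrite patchE /G/=; case: ifPn => [_|zB].
    rewrite lee_wpmul2r// lee_fin ler_piMl// indicE.
  rewrite indicE memNset ?mul0r ?mul0e//.
  move=> /= uB; move: zB; rewrite notin_setE; apply; rewrite /eball /=.
  have -> : (z - x = u - (u + x - z))%R by rewrite opprB opprD addrCA addNKr.
  apply: le_lt_trans (enormD _ _) _; rewrite enormN ltrD2l.
  apply: le_lt_trans (_ : r < _)%R; last by lra.
  by rewrite -[X in enorm X]subr0.
rewrite lee_wpmul2l// ?lee_fin//; exact: hH.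
Qed.

End convolution_bound.

(** * The dilated kernels and the moment of the profile *)

Section profile.
Context {R : realType}.
Implicit Types phi : R -> R.

(** The profile [phi] is only meaningful on the positive reals; setting it to [0]
    elsewhere makes it nonnegative and measurable on the whole line. *)
Definition positive_profile phi (t : R) : R := if 0 < t then phi t else 0.

Lemma positive_profile_ge0 phi t : (forall t, 0 < t -> 0 <= phi t) ->
  0 <= positive_profile phi t.
Proof. by rewrite /positive_profile => phi0; case: ifPn => // /phi0. Qed.

(** Extending [phi] by an upper bound to the left of [0] gives a function that is
    nonincreasing on the whole line, hence measurable. *)
Lemma measurable_positive_profile phi :
  (exists M : R, forall t, 0 < t -> phi t <= M) ->
  (forall s t, 0 < s -> s <= t -> phi t <= phi s) ->
  measurable_fun setT (positive_profile phi).
Proof.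
move=> [M phiM] phi_ni.
pose g t := if 0 < t then phi t else M.
have -> : positive_profile phi = (fun t => if 0 < t then g t else 0).
  by apply/funext => t; rewrite /positive_profile /g; case: ifPn.
apply: measurable_fun_ifT => //.
  exact: measurable_fun_ltr.
apply: nonincreasing_measurable => // s t st; rewrite /g.
have [t0|t0] := ltP 0 t; have [s0|s0] := ltP 0 s.
- exact: phi_ni.
- exact: phiM.
- by have := lt_le_trans s0 st; rewrite ltNge t0.
- by [].
Qed.

(** [s^-1] equals [s] times the real power [-1] of [s ^+ 2], also at [0]. *)
Lemma measurable_invr : measurable_fun setT (fun s : R => s^-1).
Proof.
have -> : (fun s : R => s^-1) = (fun s => s * (s ^+ 2) `^ (-1)).
  apply/funext => s; rewrite powR_inv1 ?sqr_ge0//.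
  have [->|s0] := eqVneq s 0; first by rewrite invr0 mul0r.
  by rewrite expr2 invfM mulrA divff// mul1r.
apply: measurable_funM => //.
apply: (@measurableT_comp _ _ _ _ _ _ (@powR R ^~ (-1))) => //.
Qed.

Variable n : nat.
Definition dilated_kernel phi (s : R) (u : 'rV[R]_n) : R :=
  (s ^+ n)^-1 * positive_profile phi (enorm u / s).

Lemma dilated_kernel_ge0 phi s u : (forall t, 0 < t -> 0 <= phi t) ->
  0 <= dilated_kernel phi s u.
Proof.
move=> phi0; have [s0|s0] := leP 0 s.
  by rewrite mulr_ge0 ?invr_ge0 ?exprn_ge0// positive_profile_ge0.
rewrite /dilated_kernel /positive_profile ifF ?mulr0//.
by apply/negP/negP; rewrite -leNgt mulr_ge0_le0 ?enorm_ge0// invr_le0 ltW.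
Qed.

Lemma dilated_kernel0 phi u : dilated_kernel phi 0 u = 0.
Proof. by rewrite /dilated_kernel /positive_profile invr0 mulr0 ltxx mulr0. Qed.

Lemma dilated_kernelN phi s u : dilated_kernel phi s (- u) = dilated_kernel phi s u.
Proof. by rewrite /dilated_kernel enormN. Qed.

Lemma measurable_dilated_kernel phi :
  (exists M : R, forall t, 0 < t -> phi t <= M) ->
  (forall s t, 0 < s -> s <= t -> phi t <= phi s) ->
  measurable_fun setT (fun p : R * 'rV[R]_n => dilated_kernel phi p.1 p.2).
Proof.
move=> phiM phi_ni; apply: measurable_funM.
  apply: (measurableT_comp measurable_invr); apply: measurable_funX.
  exact: measurable_fst.
apply: (measurableT_comp (measurable_positive_profile phiM phi_ni)).
apply: measurable_funM.
  exact: (measurableT_comp (@measurable_enorm R n) measurable_snd).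
exact: (measurableT_comp measurable_invr measurable_fst).
Qed.

End profile.

Section moment.
Context {R : realType} (n : nat) (phi : R -> R).
Hypothesis n_ge1 : (1 <= n)%N.
Hypothesis phi_ge0 : forall t, 0 < t -> 0 <= phi t.
Hypothesis phi_bounded : exists M : R, forall t, 0 < t -> phi t <= M.
Hypothesis phi_nonincreasing : forall s t, 0 < s -> s <= t -> phi t <= phi s.
Local Open Scope ereal_scope.
Local Notation mu := (lebesgue_rV R n).

Definition profile_moment : \bar R :=
  \int[mu]_v (positive_profile phi (enorm v) * (enorm v + 2) ^+ n)%:E.

Let psi := positive_profile phi.
Let psi0 t : (0 <= psi t)%R. Proof. exact: positive_profile_ge0. Qed.
Let mpsi : measurable_fun setT (fun v : 'rV[R]_n => psi (enorm v)).
Proof.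
exact: (measurableT_comp (measurable_positive_profile phi_bounded phi_nonincreasing)
  (@measurable_enorm R n)).
Qed.

Lemma profile_moment_ge0 : 0 <= profile_moment.
Proof.
apply: integral_ge0 => v _; rewrite lee_fin mulr_ge0 ?psi0//.
by rewrite exprn_ge0// addr_ge0 ?enorm_ge0.
Qed.

(** Where [enorm v < 1] the integrand is at most [3 ^+ n] times a bound of [phi];
    elsewhere [enorm v + 2 <= 3 * enorm v] and the moment of order [n] takes over. *)
Lemma profile_moment_lty :
  \int[mu]_x (enorm x ^+ n * phi (enorm x))%:E < +oo -> profile_moment < +oo.
Proof.
move=> fin; have [M0 phiM0] := phi_bounded.
pose M := Num.max M0 0%R.
have M_ge0 : (0 <= M)%R by rewrite le_max lexx orbT.
have psiM t : (psi t <= M)%R.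
  by rewrite /psi /positive_profile; case: ifPn => [t0|_//]; rewrite le_max phiM0.
pose f1 (v : 'rV[R]_n) := (enorm v ^+ n * psi (enorm v))%:E.
pose f2 (v : 'rV[R]_n) := (M * \1_(eball 0%R 2) v)%:E.
have f1E : \int[mu]_x (enorm x ^+ n * phi (enorm x))%:E = \int[mu]_v f1 v.
  apply: eq_integral => v _; rewrite /f1 /psi /positive_profile.
  case: ifPn => // v0; have -> : enorm v = 0%R.
    by apply/eqP; rewrite eq_le enorm_ge0 andbT leNgt.
  by rewrite expr0n eqn0Ngt n_ge1 !mul0r.
have mf1 : measurable_fun setT f1.
  apply/measurable_EFinP; apply: measurable_funM => //.
  by apply: measurable_funX; exact: measurable_enorm.
have f10 v : 0 <= f1 v by rewrite lee_fin mulr_ge0// exprn_ge0 ?enorm_ge0.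
have mf2 : measurable_fun setT f2.
  apply/measurable_EFinP; apply: measurable_funM => //.
  by apply: measurable_indic; exact: measurable_eball.
have f20 v : 0 <= f2 v by rewrite lee_fin mulr_ge0.
apply: (@le_lt_trans _ _ (((3 ^+ n)%:E * \int[mu]_v (f1 v + f2 v))%E)).
  rewrite -ge0_integralZl//; last 2 first.
  - exact: emeasurable_funD.
  - by move=> v _; rewrite adde_ge0.
  apply: le_integral_ge0 => v _; first by rewrite mule_ge0 ?adde_ge0// lee_fin exprn_ge0.
  rewrite /f1 /f2 -EFinD -EFinM lee_fin.
  have [v1|v1] := ltP (enorm v) 1%R.
    rewrite indicE mem_set ?mulr1; last by rewrite /eball/= subr0; lra.
    rewrite -/psi mulrC; apply: ler_pM; rewrite ?exprn_ge0 ?addr_ge0 ?enorm_ge0//.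
      by rewrite lerXn2r ?nnegrE ?addr_ge0 ?enorm_ge0//; lra.
    by rewrite ler_wpDl// mulr_ge0 ?exprn_ge0 ?enorm_ge0.
  apply: (@le_trans _ _ (3 ^+ n * (enorm v ^+ n * psi (enorm v))))%R; last first.
    by rewrite ler_wpM2l ?exprn_ge0// lerDl mulr_ge0.
  rewrite mulrA -exprMn mulrC -/psi ler_wpM2r//.
  by rewrite lerXn2r ?nnegrE ?mulr_ge0 ?addr_ge0 ?enorm_ge0//; lra.
rewrite ge0_integralD// -f1E lte_mul_pinfty ?lee_fin ?exprn_ge0//.
rewrite lte_add_pinfty//.
have -> : \int[mu]_v f2 v = M%:E * mu (eball 0%R 2).
  rewrite /f2; under eq_integral do rewrite EFinM.
  rewrite ge0_integralZl//; last first.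
    by apply/measurable_EFinP; apply: measurable_indic; exact: measurable_eball.
  by rewrite integral_indic ?setIT//; exact: measurable_eball.
rewrite lte_mul_pinfty ?lee_fin//.
apply: le_lt_trans (ltry ((2 * 2) ^+ n)).
exact: lebesgue_rV_eball_le.
Qed.

(** Substituting [u = s *: v], the factor [s ^+ n] cancels against the normalisation
    of the kernel, and [s * enorm v + 2 * r <= r * (enorm v + 2)] since [s <= r]. *)
Lemma dilated_kernel_weighted_le (s r : R) (H : \bar R) :
  (0 < s)%R -> (s <= r)%R -> 0 <= H ->
  \int[mu]_u ((dilated_kernel phi s u * (2 * (enorm u + 2 * r)) ^+ n)%:E * H) <=
  ((2 * r) ^+ n)%:E * (profile_moment * H).
Proof.
move=> s0 sr H0; have r0 := lt_le_trans s0 sr.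
have w0 (v : 'rV[R]_n) c : (0 <= c -> 0 <= (enorm v + c) ^+ n)%R.
  by move=> c0; rewrite exprn_ge0// addr_ge0 ?enorm_ge0.
pose g (u : 'rV[R]_n) : \bar R :=
  (dilated_kernel phi s u * (2 * (enorm u + 2 * r)) ^+ n)%:E * H.
have g0 u : 0 <= g u.
  rewrite /g mule_ge0// lee_fin mulr_ge0 ?dilated_kernel_ge0//.
  by rewrite exprn_ge0// mulr_ge0// addr_ge0 ?enorm_ge0// mulr_ge0// ltW.
have mg : measurable_fun setT g.
  apply: emeasurable_funM => //; apply/measurable_EFinP.
  apply: measurable_funM.
    exact: (measurableT_comp (measurable_dilated_kernel phi_bounded phi_nonincreasing)
      (measurable_pair1 s)).
  apply: measurable_funX; apply: measurable_funM => //.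
  apply: measurable_funD => //; exact: measurable_enorm.
pose w (v : 'rV[R]_n) : \bar R := (psi (enorm v) * (enorm v + 2) ^+ n)%:E.
have wt0 v : 0 <= w v by rewrite lee_fin mulr_ge0 ?psi0// w0.
have mw : measurable_fun setT w.
  apply/measurable_EFinP; apply: measurable_funM => //.
  by apply: measurable_funX; apply: measurable_funD => //; exact: measurable_enorm.
have r2 : (0 <= (2 * r) ^+ n)%R by rewrite exprn_ge0// mulr_ge0// ltW.
rewrite (@ge0_integral_rV_affine _ _ s 0%R)//.
rewrite -ge0_integralZl ?lee_fin ?exprn_ge0 ?(ltW s0)//; last 2 first.
- exact: (measurableT_comp mg (measurable_rV_affine s 0%R)).
- by move=> v _; exact: g0.
have -> : profile_moment = \int[mu]_v w v by [].
rewrite -ge0_integralZr// -ge0_integralZl//; last 2 first.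
- exact: emeasurable_funM.
- by move=> v _; rewrite mule_ge0.
apply: le_integral_ge0 => v _.
  by rewrite !mule_ge0// lee_fin.
rewrite /g /w /=.
rewrite !muleA lee_wpmul2r// -!EFinM lee_fin addr0 enormZ ?(ltW s0)//.
rewrite /dilated_kernel enormZ ?(ltW s0)//.
rewrite [(s * enorm v)%R]mulrC mulfK ?gt_eqF//.
rewrite -/psi [(enorm v * s)%R]mulrC.
have -> : (s ^+ n * ((s ^+ n)^-1 * psi (enorm v) * (2 * (s * enorm v + 2 * r)) ^+ n) =
  psi (enorm v) * (2 * (s * enorm v + 2 * r)) ^+ n)%R.
  by rewrite !mulrA divff ?mul1r// expf_neq0// gt_eqF.
rewrite mulrCA ler_wpM2l// -exprMn lerXn2r ?nnegrE//.
- rewrite mulr_ge0// addr_ge0// mulr_ge0 ?enorm_ge0// ltW//.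
- by rewrite !mulr_ge0// ?addr_ge0 ?enorm_ge0// ltW.
- rewrite -mulrA ler_pM2l// mulrDr [(r * 2)%R]mulrC lerD2r.
  by rewrite ler_wpM2r ?enorm_ge0.
Qed.

End moment.

(** * Bounds by the maximal function *)

Section maximal_function.
Context {R : realType} (n : nat).
Local Open Scope ereal_scope.
Local Notation mu := (lebesgue_rV R n).

Lemma lebesgue_rV_set1 (a : 'rV[R]_n) : (1 <= n)%N ->
  measurable [set a] /\ mu [set a] = 0.
Proof.
move=> n1.
have aE : [set a] = [set v | forall i, [set a ord0 i] (v ord0 i)].
  apply/seteqP; split => [v -> //|v /= va].
  by apply/rowP => i; exact: va.
split.
  have -> : [set a] = eclosed_ball a 0.
    apply/seteqP; split => [v ->|v]; rewrite /eclosed_ball/=.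
      by rewrite subrr enorm0.
    move=> va; apply/eqP; rewrite -subr_eq0; apply: contraT => /enorm_gt0.
    by rewrite ltNge va.
  exact: measurable_eclosed_ball.
rewrite aE (lebesgue_rV_box (A := fun i => [set a ord0 i]))//; case: n n1 a aE => // k _ a _.
by rewrite big_ord_recl lebesgue_measure_set1 mul0e.
Qed.

Lemma HL_maximal_rV_ge0 (f : 'rV[R]_n -> R) x : 0 <= HL_maximal_rV f x.
Proof.
apply: le_trans (ereal_sup_ubound _); last by exists 1%R => //=; exact: ltr01.
by rewrite mule_ge0 ?inve_ge0// integral_ge0.
Qed.

Lemma integral_eball_le_HL_maximal (f : 'rV[R]_n -> R) (h : 'rV[R]_n -> \bar R) x rho :
  measurable_fun setT h -> (forall z, 0 <= h z) -> (forall z, h z <= `|(f z)%:E|) ->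
  (0 < rho)%R ->
  \int[mu]_(z in eball x rho) h z <= ((2 * rho) ^+ n)%:E * HL_maximal_rV f x.
Proof.
move=> mh h0 hf rho0.
have mB : measurable (eball x rho) by exact: measurable_eball.
have Ble := lebesgue_rV_eball_le x (ltW rho0).
(* Were the volume of the ball zero, its inverse would be [+oo]; the integral over
   the ball then vanishes anyway. *)
have [B0|B0] := eqVneq (mu (eball x rho)) 0.
  rewrite null_set_integral//; last exact: measurable_funS mh.
  rewrite mule_ge0 ?HL_maximal_rV_ge0// lee_fin exprn_ge0// mulr_ge0// ltW//.
have Bfin : mu (eball x rho) \is a fin_num.
  by rewrite ge0_fin_numE// (le_lt_trans Ble)// ltry.
apply: (@le_trans _ _ (\int[mu]_(z in eball x rho) `|(f z)%:E|)).
  exact: le_integral_ge0.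
apply: (@le_trans _ _ (mu (eball x rho) * HL_maximal_rV f x)); last first.
  by rewrite lee_wpmul2r ?HL_maximal_rV_ge0.
have -> : \int[mu]_(z in eball x rho) `|(f z)%:E| = mu (eball x rho) *
    ((mu (eball x rho))^-1 * \int[mu]_(z in eball x rho) `|(f z)%:E|).
  rewrite muleA -(fineK Bfin) inver ifF; last first.
    by apply/negbTE; rewrite -(fineK Bfin) in B0.
  by rewrite -EFinM divff ?mul1e//; rewrite -(fineK Bfin) in B0.
rewrite lee_wpmul2l//; apply: ereal_sup_ubound; by exists rho.
Qed.

End maximal_function.

(** * Averaging the dilated kernels over scales and centres *)

Section kernel_average.
Context {R : realType} (n : nat) (phi : R -> R).
Hypothesis phi_ge0 : forall t, 0 < t -> 0 <= phi t.
Hypothesis phi_bounded : exists M : R, forall t, 0 < t -> phi t <= M.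
Hypothesis phi_nonincreasing : forall s t, 0 < s -> s <= t -> phi t <= phi s.
Local Open Scope ereal_scope.
Local Notation mu := (lebesgue_rV R n).
Variables (h : 'rV[R]_n -> \bar R) (x : 'rV[R]_n) (H : \bar R).
Hypothesis mh : measurable_fun setT h.
Hypothesis h0 : forall z, 0 <= h z.
Hypothesis H0 : 0 <= H.
Hypothesis hH : forall rho : R, (0 < rho)%R ->
  \int[mu]_(z in eball x rho) h z <= ((2 * rho) ^+ n)%:E * H.

Definition kernel_average (p : R * 'rV[R]_n) : \bar R :=
  \int[mu]_z ((dilated_kernel phi p.1 (x - p.2 - z))%:E * h z).

Lemma kernel_average_ge0 p : 0 <= kernel_average p.
Proof.
apply: integral_ge0 => z _; rewrite mule_ge0// lee_fin.
exact: dilated_kernel_ge0.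
Qed.

Lemma measurable_average_integrand :
  measurable_fun setT (fun q : (R * 'rV[R]_n) * 'rV[R]_n =>
    (dilated_kernel phi q.1.1 (x - q.1.2 - q.2))%:E * h q.2).
Proof.
apply: emeasurable_funM; last exact: (measurableT_comp mh measurable_snd).
apply/measurable_EFinP.
have marg : measurable_fun setT (fun q : (R * 'rV[R]_n) * 'rV[R]_n =>
    (q.1.1, x - q.1.2 - q.2)%R).
  apply: measurable_fun_pair.
    exact: (measurableT_comp measurable_fst measurable_fst).
  apply: measurable_rVD; last by apply: measurable_rVN; exact: measurable_snd.
  apply: measurable_rVD => //; apply: measurable_rVN.
  exact: (measurableT_comp measurable_snd measurable_fst).
exact: (measurableT_comp
  (measurable_dilated_kernel phi_bounded phi_nonincreasing) marg).
Qed.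

Lemma measurable_kernel_average : measurable_fun setT kernel_average.
Proof.
have := @measurable_fun_fubini_tonelli_F _ _ _ _ _ mu _ measurable_average_integrand; apply.
by move=> q; rewrite mule_ge0// lee_fin dilated_kernel_ge0.
Qed.

(** The bound is uniform in [s <= r], although the kernel concentrates as [s] tends
    to [0]: the average over [y] already takes place at the scale [r]. *)
Lemma kernel_average_slice_le (r s : R) : (0 <= s)%R -> (s <= r)%R -> (0 < r)%R ->
  \int[mu]_(y in eclosed_ball 0%R r) kernel_average (s, y) <=
  ((2 * r) ^+ n)%:E * (profile_moment n phi * H).
Proof.
move=> s0 sr r0; move: s0; rewrite le_eqVlt => /predU1P[<-|s0].
  rewrite integral0_eq; last first.
    by move=> y _; apply: integral0_eq => z _; rewrite dilated_kernel0 mul0e.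
  by rewrite mule_ge0 ?mule_ge0 ?profile_moment_ge0// lee_fin exprn_ge0// mulr_ge0// ltW.
apply: le_trans (dilated_kernel_weighted_le n phi_ge0 phi_bounded phi_nonincreasing s0 sr H0).
apply: (@averaged_convolution_le _ _ (dilated_kernel phi s)) => //.
- exact: (measurableT_comp (measurable_dilated_kernel phi_bounded phi_nonincreasing)
      (measurable_pair1 s)).
- by move=> u; exact: dilated_kernel_ge0.
- by move=> u; exact: dilated_kernelN.
Qed.

Lemma kernel_average_box_le (r : R) : (0 < r)%R ->
  \int[lebesgue_measure \x mu]_(p in `[0%R, r] `*` eclosed_ball 0%R r)
    kernel_average p <=
  ((2 * r) ^+ n * r)%:E * (profile_moment n phi * H).
Proof.
move=> r0; set B := eclosed_ball _ _.
have mB : measurable B by exact: measurable_eclosed_ball.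
have mI : measurable (`[0%R, r] : set (measurableTypeR R)) by exact: measurable_itv.
have mS := measurableX mI mB.
rewrite integral_mkcond fubini_tonelli1//; last 2 first.
- by apply/(measurable_restrictT _ mS); exact: measurable_funS measurable_kernel_average.
- by move=> p; apply: erestrict_ge0 => q _; exact: kernel_average_ge0.
set Q := ((2 * r) ^+ n)%:E * (profile_moment n phi * H).
have Q0 : 0 <= Q.
  by rewrite mule_ge0 ?mule_ge0 ?profile_moment_ge0// lee_fin exprn_ge0// mulr_ge0// ltW.
apply: (@le_trans _ _ (\int[lebesgue_measure]_(s in `[0%R, r]) Q)); last first.
  rewrite integral_cst// [X in _ * X <= _](_ : _ = r%:E); last first.
    by rewrite [LHS]lebesgue_measure_itv/= lte_fin r0 sube0.
  by rewrite muleC muleA -EFinM mulrC.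
rewrite [leRHS]integral_mkcond; apply: le_integral_ge0 => s _.
  by apply: erestrict_ge0 => t _.
rewrite /fubini_F patchE; case: ifPn => sI.
  move: (sI); rewrite inE/= in_itv/= => /andP[s0 sr].
  apply: le_trans (kernel_average_slice_le s0 sr r0).
  rewrite [leRHS]integral_mkcond le_eqVlt; apply/orP; left; apply/eqP.
  by apply: eq_integral => y _; rewrite !patchE in_setX sI.
rewrite integral0_eq// => y _; rewrite patchE in_setX (negbTE sI)//.
Qed.

End kernel_average.


(** * The maximal operator *)

Theorem theorem3p8 (R : realType) (n : nat) (n_ge1 : (1 <= n)%N)
    (phi : R -> R)
    (phi_ge0 : forall t, 0 < t -> 0 <= phi t)
    (phi_bounded : exists M : R, forall t, 0 < t -> phi t <= M)
    (phi_nonincreasing : forall s t, 0 < s -> s <= t -> phi t <= phi s)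
    (phi_moment :
      (\int[lebesgue_rV R n]_x (enorm x ^+ n * phi (enorm x))%:E < +oo)%E)
    (d : measure_display) (Omega : measurableType d) (P : probability Omega R)
    (eps : nat -> {RV P >-> R}) (y : nat -> {RV P >-> 'rV[R]_n})
    (eps_gt0 : forall j, (1 <= j)%N -> forall w, 0 < eps j w)
    (gamma : nat -> R * 'rV[R]_n -> R)
    (gamma_measurable : forall j, (1 <= j)%N ->
      completed_measurable_fun (lebesgue_measure \x lebesgue_rV R n)%E (gamma j))
    (gamma_density : forall j, (1 <= j)%N ->
      forall E : set (R * 'rV[R]_n), measurable E ->
        joint_distribution (eps j) (y j) E =
        (\int[lebesgue_measure \x lebesgue_rV R n]_(p in E) (gamma j p)%:E)%E)
    (A : R) (A_gt0 : 0 < A)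
    (r : nat -> R) (r_gt0 : forall j, (1 <= j)%N -> 0 < r j)
    (gamma_supp : forall j, (1 <= j)%N ->
      closure [set p | gamma j p != 0] `<=`
        `[0, r j]%classic `*` eclosed_ball 0 (r j))
    (gamma_bound : forall j, (1 <= j)%N ->
      ('N[lebesgue_measure \x lebesgue_rV R n]_+oo[EFin \o gamma j]
        <= (A / r j ^+ n.+1)%:E)%E) :
  exists C : R, 0 < C /\
    forall f : 'rV[R]_n -> R, completed_measurable_fun (lebesgue_rV R n) f ->
      forall x : 'rV[R]_n,
        (random_maximal phi eps y f x <= C%:E * HL_maximal_rV f x)%E.
Proof.
have [I I0 IE] : exists2 I : R, 0 <= I & profile_moment n phi = I%:E.
  have fin : profile_moment n phi \is a fin_num.
    by rewrite ge0_fin_numE ?profile_moment_ge0// profile_moment_lty.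
  exists (fine (profile_moment n phi)); last by rewrite fineK.
  by rewrite fine_ge0// profile_moment_ge0.
(* The summand [1] only serves to make the constant positive. *)
exists (A * 2 ^+ n * I + 1); split.
  by rewrite ltr_wpDl// !mulr_ge0// ltW.
move=> f mf x.
have [h [mh h0 hf hfae]] := completed_measurable_fun_envelope mf.
set H := HL_maximal_rV f x.
have H0 : (0 <= H)%E by exact: HL_maximal_rV_ge0.
have hH rho : 0 < rho -> (\int[lebesgue_rV R n]_(z in eball x rho) h z <=
    ((2 * rho) ^+ n)%:E * H)%E by exact: integral_eball_le_HL_maximal.
apply: ge_ereal_sup => _ [j /= j1 <-].
have ej := eps_gt0 _ j1; have rj := r_gt0 _ j1.
pose Z w : measurableTypeR R * 'rV[R]_n := (eps j w, y j w).
(* The first factor is given the generated Borel structure that carries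
   [lebesgue_measure], so that the law of [Z] and the product measure live on the
   same measurable type. *)
have mZ0 : measurable_fun setT (fun w => (eps j w, y j w)) by exact: measurable_fun_pair.
have mZ : measurable_fun setT Z := mZ0.
have mK := measurable_kernel_average phi_ge0 phi_bounded phi_nonincreasing x mh h0.
have K0 := kernel_average_ge0 phi_ge0 x h0.
apply: (@le_trans _ _ (\int[P]_w kernel_average phi h x (Z w))%E).
  apply: le_integral_ge0 => w _; first exact: K0.
  apply: ae_le_integral_ge0 => //.
  - exact: (measurableT_comp (measurable_average_integrand phi_bounded
      phi_nonincreasing x mh) (measurable_pair1 (Z w))).
  - by move=> z; rewrite mule_ge0// lee_fin dilated_kernel_ge0.
  (* The value of [phi] at [0], which is unconstrained, is read only at the single
     point [z = x - y j w], a null set. *)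
  have [m1 mu1] := lebesgue_rV_set1 (x - y j w) n_ge1.
  have zae : {ae lebesgue_rV R n, forall z, z != x - y j w}.
    by exists [set x - y j w]; split => // z /= /negP; rewrite negbK => /eqP.
  apply: filterS2 hfae zae => z -> zx _.
  rewrite abse_EFin -EFinM lee_fin /dilated_kernel /positive_profile /= ifT//.
  by rewrite divr_gt0// enorm_gt0// subr_eq0 eq_sym.
have -> : (\int[P]_w kernel_average phi h x (Z w) =
    \int[pushforward P Z]_p kernel_average phi h x p)%E.
  by rewrite ge0_integral_pushforward.
pose c := A / r j ^+ n.+1.
have c0 : 0 <= c by rewrite divr_ge0// ?exprn_ge0// ltW.
have mS : measurable (`[0, r j]%classic `*` eclosed_ball 0 (r j) :
    set (measurableTypeR R * 'rV[R]_n)).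
  by apply: measurableX; [exact: measurable_itv|exact: measurable_eclosed_ball].
have gS t : ~ (`[0, r j]%classic `*` eclosed_ball 0 (r j)) t -> gamma j t = 0.
  move=> St; apply/eqP; apply: contra_notT St => gt.
  by apply: gamma_supp => //; exact: subset_closure.
have L : (\int[pushforward P Z]_p kernel_average phi h x p <=
    c%:E * \int[lebesgue_measure \x lebesgue_rV R n]_(p in
   `[0%R, r j]%classic `*` eclosed_ball 0%R (r j)) kernel_average phi h x p)%E.
  pose nu := (pushforward P Z : {measure set (measurableTypeR R * 'rV[R]_n) -> \bar R}).
  apply: (@bounded_density_integral_le _ _ R (nu mZ) _ (gamma j)) => //.
  - exact: gamma_density.
  - exact: gamma_bound.
apply: (le_trans L).
apply: (@le_trans _ _ (c%:E * (((2 * r j) ^+ n * r j)%:E * (I%:E * H)))%E).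
  by rewrite lee_wpmul2l// -IE kernel_average_box_le.
rewrite !muleA -!EFinM lee_wpmul2r// lee_fin.
have -> : c * ((2 * r j) ^+ n * r j) * I = A * 2 ^+ n * I.
  rewrite /c exprMn exprS; congr (_ * _).
  have rn0 : r j ^+ n != 0 by rewrite expf_neq0// gt_eqF.
  by move: (r j ^+ n) (2 ^+ n) rn0 => u v u0; field; rewrite u0 gt_eqF.
by rewrite lerDl.
Qed.
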